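(* Let $G$ be a connected finite simple $d$-regular graph ($d\ge2$) with $n$ vertices and $m$ edges, and let ${\bf U}$ be the transition probability matrix of the correlated random walk on $G$ with respect to the $d\times d$ matrix $\frac1d{\bf J}_d$. Then, counting with multiplicity, ${\bf U}$ has $n$ eigenvalues of the form $$\lambda=\frac1d\lambda_A,\qquad \lambda_A\in\mathrm{Spec}({\bf A}(G)),$$ where $\lambda_A$ runs over the eigenvalues (with multiplicity) of the adjacency matrix ${\bf A}(G)$. The remaining $2m-n$ eigenvalues of ${\bf U}$ are $0$ (with multiplicity $2m-n$).
   Context: For a finite simple graph $G$, $D(G)=\{(u,v),(v,u)\mid uv\in E(G)\}$ is its set of arcs; for $e=(u,v)\in D(G)$ write $o(e)=u$, $t(e)=v$. ${\bf J}_d$ is the $d\times d$ all-ones matrix. The transition probability matrix of the correlated random walk on the $d$-regular graph $G$ with respect to $\frac1d{\bf J}_d$ is the $2m\times 2m$ matrix ${\bf U}=(U_{ef})_{e,f\in D(G)}$ with $U_{ef}=1/d$ if $t(e)=o(f)$ and $U_{ef}=0$ otherwise. *)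

(* Defs.v *)
From mathcomp Require Import all_boot all_order all_algebra.

Set Implicit Arguments.
Unset Strict Implicit.
Unset Printing Implicit Defensive.

Import GRing.Theory.
Local Open Scope ring_scope.

(* A finite simple graph with vertex set V is a symmetric irreflexive
   relation on the finite type V. *)
Section Graphs.
Variables (V : finType) (G : rel V).

Definition simple_graph : Prop := symmetric G /\ irreflexive G.

(* Connected graphs are nonempty, as usual. *)
Definition connected_graph : Prop :=
  (0 < #|V|)%N /\ forall u v : V, connect G u v.

Definition regular_graph (d : nat) : Prop :=
  forall u : V, #|[set v | G u v]| = d.

Definition edges : {set {set V}} :=
  [set [set p.1; p.2] | p : V * V & G p.1 p.2].

Definition graph_arc : finType := {a : V * V | G a.1 a.2}.

Definition origin (a : graph_arc) : V := (val a).1.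
Definition terminus (a : graph_arc) : V := (val a).2.

End Graphs.

(* Matrices indexed by a finite type T are square matrices of size #|T|,
   with enum_val : 'I_#|T| -> T translating the indices. *)
Definition adjacency_mx (R : nzRingType) (V : finType) (G : rel V) :
    'M[R]_#|V| :=
  \matrix_(i, j) (G (enum_val i) (enum_val j))%:R.

(* The correlated random walk with respect to the matrix d^-1 J_d. *)
Definition transition_mx (F : fieldType) (V : finType) (G : rel V) (d : nat) :
    'M[F]_#|graph_arc G| :=
  \matrix_(i, j)
    if terminus (enum_val i) == origin (enum_val j) then d%:R^-1 else 0.

(* The eigenvalues of M, listed with algebraic multiplicity in an unspecified
   order: the sequence of roots of the characteristic polynomial. *)
Definition spectrum (C : closedFieldType) (n : nat) (M : 'M[C]_n) : seq C :=
  sval (closed_field_poly_normal (char_poly M)).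

Lemma spectrumE (C : closedFieldType) (n : nat) (M : 'M[C]_n) :
  char_poly M = \prod_(x <- spectrum M) ('X - x%:P).
Proof.
rewrite /spectrum; case: closed_field_poly_normal => s /= Ds.
by rewrite {1}Ds (monicP (char_poly_monic M)) scale1r.
Qed.

Lemma size_spectrum (C : closedFieldType) (n : nat) (M : 'M[C]_n) :
  size (spectrum M) = n.
Proof.
by apply: succn_inj; rewrite -(size_char_poly M) spectrumE size_prod_XsubC.
Qed.

(* Main.v *)
Require Import Defs.
From mathcomp Require Import all_boot all_order all_algebra.

Set Implicit Arguments.
Unset Strict Implicit.
Unset Printing Implicit Defensive.

Import GRing.Theory.
Local Open Scope ring_scope.

(** The walk matrix factors through the vertices: if T and O are the 0-1
    matrices recording the terminus and the origin of each arc, with arcs as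
    rows and vertices as columns, then U = d^-1 T O^T, because the (e, f) entry
    of T O^T counts the vertices that are both t(e) and o(f).  In the other
    order O^T T counts the arcs from one vertex to another, so it is A.

    Since X Y and Y X have the same characteristic polynomial up to powers of
    the variable ([char_poly_mulmxC]), U has the spectrum of d^-1 A, padded
    with zeros up to the number of arcs ([spectrum_mulmxC]).  Scaling by d^-1
    scales the spectrum of A ([spectrum_scale]), and the number of zeros is
    2m - n because each edge carries two arcs ([card_graph_arc]). *)

(** Both sides compute the determinant of the block matrix
    ['X, X; Y, 1] times 'X^q, by clearing the lower left block with column
    operations on one side and with row operations on the other. *)
Lemma char_poly_mulmxC (R : comNzRingType) (p q : nat)
    (X : 'M[R]_(p, q)) (Y : 'M[R]_(q, p)) :
  'X^q * char_poly (X *m Y) = 'X^p * char_poly (Y *m X).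
Proof.
rewrite /char_poly /char_poly_mx !map_mxM /=.
set P := map_mx _ X; set Q := map_mx _ Y.
pose M : 'M[{poly R}]_(p + q) := block_mx 'X%:M P Q 1%:M.
have colM : M *m block_mx 1%:M 0 (- Q) 1%:M
    = block_mx ('X%:M - P *m Q) P 0 1%:M.
  rewrite mulmx_block !mulmx1 !mulmx0 !mul1mx mulmxN !add0r.
  by rewrite subrr.
have rowM : block_mx 1%:M 0 (- Q) 'X%:M *m M
    = block_mx 'X%:M P 0 ('X%:M - Q *m P).
  rewrite mulmx_block !mul1mx !mul0mx !addr0 !mulNmx mulmx1.
  by rewrite mul_mx_scalar mul_scalar_mx addNr addrC.
have := congr1 determinant rowM; have := congr1 determinant colM.
rewrite !det_mulmx !det_ublock !det_lblock !det1 !mulr1 !mul1r.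
by rewrite !det_scalar => <-.
Qed.

Lemma spectrum_mulmxC (C : closedFieldType) (p q : nat)
    (X : 'M[C]_(p, q)) (Y : 'M[C]_(q, p)) :
  (q <= p)%N ->
  perm_eq (spectrum (X *m Y)) (spectrum (Y *m X) ++ nseq (p - q) 0).
Proof.
move=> le_qp; apply: prod_XsubC_eq.
apply: (mulfI (monic_neq0 (monicXn C q))).
rewrite -spectrumE char_poly_mulmxC big_cat /= -spectrumE big_nseq.
by rewrite subr0 -Monoid.iteropE mulrCA -exprD subnKC // mulrC.
Qed.

(** The characteristic matrix of c M is c times that of M evaluated at
    c^-1 'X, so each factor 'X - x becomes c (c^-1 'X - x) = 'X - c x. *)
Lemma spectrum_scale (C : closedFieldType) (n : nat) (c : C) (M : 'M[C]_n) :
  c != 0 -> perm_eq (spectrum (c *: M)) [seq c * x | x <- spectrum M].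
Proof.
move=> c_neq0; apply: prod_XsubC_eq; rewrite -spectrumE big_map.
have cC : c%:P * c^-1%:P = 1 :> {poly C} by rewrite -polyCM mulfV.
have -> : char_poly (c *: M) = c%:P ^+ n * (char_poly M \Po (c^-1 *: 'X)).
  rewrite /char_poly -det_map_mx -detZ; congr determinant.
  apply/matrixP=> i j; rewrite !mxE rmorphB rmorphMn /= comp_polyX comp_polyC.
  by rewrite mulrBr mulrnAr -mul_polyC mulrA cC mul1r polyCM.
have -> : c%:P ^+ n = \prod_(x <- spectrum M) c%:P :> {poly C}.
  by rewrite big_const_seq count_predT size_spectrum -Monoid.iteropE.
rewrite spectrumE rmorph_prod -big_split; apply: eq_bigr => x _ /=.
rewrite rmorphB /= comp_polyX comp_polyC mulrBr -polyCM.
by rewrite -mul_polyC mulrA cC mul1r.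
Qed.

(** Distinct arcs carrying the same edge are reverses of each other, and
    irreflexivity keeps an arc different from its reverse. *)
Lemma card_graph_arc (V : finType) (G : rel V) :
  simple_graph G -> #|graph_arc G| = (2 * #|edges G|)%N.
Proof.
case=> symG irrG.
have -> : #|graph_arc G| = #|[set p : V * V | G p.1 p.2]|.
  by rewrite card_sig cardsE.
rewrite -[LHS]sum1_card /edges.
rewrite (partition_big_imset (fun p : V * V => [set p.1; p.2])) /=.
rewrite mulnC -[RHS]sum_nat_const; apply: eq_bigr => _ /imsetP[[u v] /= Guv ->].
rewrite inE /= in Guv.
have neq_uv : u != v by apply: contraTneq Guv => ->; rewrite irrG.
rewrite sum1dep_card.
have -> : [set p | (p \in [set a | G a.1 a.2])
                   && ([set p.1; p.2] == [set u; v])] = [set (u, v); (v, u)].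
  apply/setP=> -[x y]; rewrite !inE /= !xpair_eqE.
  apply/andP/idP=> [[Gxy /eqP eqE] | ].
    have neq_xy : x != y by apply: contraTneq Gxy => ->; rewrite irrG.
    have := set21 x y; have := set22 x y; rewrite eqE !inE.
    by do 2![case/orP=> /eqP ?]; subst x y; rewrite !eqxx ?orbT // in neq_xy *.
  case/orP=> /andP[/eqP-> /eqP->]; split=> //; first by rewrite symG.
  by rewrite setUC.
by rewrite cards2 xpair_eqE (negPf neq_uv).
Qed.

Lemma card_graph_arc_regular (V : finType) (G : rel V) (d : nat) :
  regular_graph G d -> #|graph_arc G| = (#|V| * d)%N.
Proof.
move=> regG; rewrite card_sig -sum1_card.
rewrite -(pair_big_dep xpredT (fun u v => G u v) (fun _ _ => 1%N)) /=.
rewrite -[RHS]sum_nat_const; apply: eq_bigr => u _.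
by rewrite sum1dep_card regG.
Qed.

(** The matrices T and O of the factorization: e is [terminus] or [origin]. *)
Definition arc_end_mx (R : nzRingType) (V : finType) (G : rel V)
    (e : graph_arc G -> V) : 'M[R]_(#|graph_arc G|, #|V|) :=
  \matrix_(a, i) (e (enum_val a) == enum_val i)%:R.

Lemma transition_mxE (F : fieldType) (V : finType) (G : rel V) (d : nat) :
  transition_mx F G d
    = arc_end_mx F (@terminus V G)
      *m (d%:R^-1 *: (arc_end_mx F (@origin V G))^T).
Proof.
apply/matrixP=> a b; rewrite -scalemxAr !mxE.
under eq_bigr do rewrite !mxE.
rewrite -(big_enum_val (A := V) (fun v => (terminus (enum_val a) == v)%:R
  * (origin (enum_val b) == v)%:R : F)) /=.
rewrite (bigD1 (terminus (enum_val a))) //= big1 => [|v /negPf neq_v]; last first.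
  by rewrite eq_sym neq_v mul0r.
by rewrite addr0 eqxx mul1r eq_sym; case: eqP; rewrite ?mulr1 ?mulr0.
Qed.

Lemma adjacency_mxE (R : nzRingType) (V : finType) (G : rel V) :
  (arc_end_mx R (@origin V G))^T *m arc_end_mx R (@terminus V G)
    = adjacency_mx R G.
Proof.
apply/matrixP=> i j; rewrite !mxE.
under eq_bigr do rewrite !mxE.
set u := enum_val i; set v := enum_val j.
rewrite -(big_enum_val (A := graph_arc G)
  (fun a => (origin a == u)%:R * (terminus a == v)%:R : R)) /=.
have [Guv | nGuv] := boolP (G u v).
  (* In a graph without multiple edges (u, v) is the only arc from u to v. *)
  rewrite (bigD1 (Sub (u, v) Guv : graph_arc G)) //= big1 => [|a neq_a].
    by rewrite /origin /terminus /= !eqxx mulr1 addr0.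
  have [ou | _] := eqVneq (origin a) u; last by rewrite mul0r.
  have [tv | _] := eqVneq (terminus a) v; last by rewrite mulr0.
  case/eqP: neq_a; apply: val_inj; rewrite /= -ou -tv.
  exact: surjective_pairing.
apply: big1 => a _.
have [ou | _] := eqVneq (origin a) u; last by rewrite mul0r.
have [tv | _] := eqVneq (terminus a) v; last by rewrite mulr0.
by case/negP: nGuv; rewrite -ou -tv; apply: (valP a).
Qed.

Theorem corollary8 (C : numClosedFieldType) (V : finType) (G : rel V)
    (d n m : nat)
    (simpleG : simple_graph G) (connG : connected_graph G)
    (d_ge2 : (2 <= d)%N) (regG : regular_graph G d)
    (cardV : #|V| = n) (cardE : #|edges G| = m) :
  #|graph_arc G| = (2 * m)%N /\
  perm_eq (spectrum (transition_mx C G d))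
    ([seq d%:R^-1 * lambda | lambda <- spectrum (adjacency_mx C G)]
       ++ nseq (2 * m - n)%N 0).
Proof.
have arcsE : #|graph_arc G| = (2 * m)%N by rewrite -cardE card_graph_arc.
have d_gt0 : (0 < d)%N by apply: ltnW.
split=> //; rewrite -arcsE -cardV transition_mxE.
apply: perm_trans (spectrum_mulmxC _ _ _) _.
  by rewrite (card_graph_arc_regular regG) leq_pmulr.
rewrite perm_cat2r -scalemxAl adjacency_mxE spectrum_scale //.
by rewrite invr_eq0 Num.Theory.pnatr_eq0 -lt0n.
Qed.
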